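(* Let $p\ge q\ge 1$ be integers. The polytope $$P_{p,q}=\{(x,y)\in\mathbb{R}^{\mathcal{I}_{p,q}}\times\mathbb{R}^{A_{p,q}} : y\in F_{p,q},\ (x,y)\text{ satisfies (a) and (b)}\},$$ where (a) is $y_{(i-1,j-1)^{\searrow}}\le x_{ij}$ for all $(i,j)\in\mathcal{I}_{p,q}$, and (b) is $x(\mathrm{bar}_{i,j})\le y(\mathrm{in}^{\searrow}(\mathrm{col}_{i,j}))$ for all $(i,j)\in\mathcal{I}_{p,q}$, is integral, i.e., all its vertices have integer coordinates.
   Context: Notation: $[n]=\{1,\dots,n\}$, $[n]_0=\{0,1,\dots,n\}$, $q(i)=\min\{i,q\}$, $\mathcal{I}_{p,q}=\{(i,j)\in[p]\times[q] : i\ge j\}$. For a vector $z\in\mathbb{R}^M$ and $N\subseteq M$, $z(N)=\sum_{e\in N}z_e$. The directed acyclic graph $D_{p,q}=(V_{p,q},A_{p,q})$ has node set $V_{p,q}=\mathcal{I}_{p,q}\uplus([p]_0\times\{0\})\uplus\{s\}\uplus\{t\}$ and the following arcs: - vertical arcs $(i,j)^{\downarrow}=((i,j),(i+1,j))$ for $i\in[p-1]_0$, $j\in[q(i)]_0$; - diagonal arcs $(i,j)^{\searrow}=((i,j),(i+1,j+1))$ for $i\in[p-1]_0$, $j\in[q(i+1)-1]_0$; - the arc $(s,(0,0))$; - the arcs $((p,j),t)$ for $j\in[q]_0$. $F_{p,q}\subseteq\mathbb{R}^{A_{p,q}}$ is the set of all $s$-$t$-flows in $D_{p,q}$ of flow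 value one without capacity restrictions: $y\ge 0$, flow conservation at every node other than $s,t$, and one unit of flow leaving $s$. For $W\subseteq V_{p,q}$, $\mathrm{in}^{\searrow}(W)$ is the set of diagonal arcs $(u,w)$ with $w\in W$, $u\notin W$. For $(i,j)\in\mathcal{I}_{p,q}$: $\mathrm{bar}_{i,j}=\{(i,\ell)\in\mathcal{I}_{p,q} : \ell\ge j\}$ and $\mathrm{col}_{i,j}=\{(k,j) : j\le k\le i\}$. *)

(* Defs.v *)
(* MathComp, with the real numbers of MathComp-Analysis *)
From HB Require Import structures.
From mathcomp Require Import all_boot all_order all_algebra.
From mathcomp Require Import classical_sets reals.
Set Implicit Arguments.
Unset Strict Implicit.
Unset Printing Implicit Defensive.
Import Order.TTheory GRing.Theory Num.Theory.
Local Open Scope ring_scope.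

Inductive node := Grid of nat & nat | Src | Snk.

Definition node_code (v : node) : nat * nat + bool :=
  match v with Grid i j => inl (i, j) | Src => inr true | Snk => inr false end.

Definition node_decode (c : nat * nat + bool) : node :=
  match c with inl (i, j) => Grid i j | inr b => if b then Src else Snk end.

Lemma node_codeK : cancel node_code node_decode.
Proof. by case. Qed.

HB.instance Definition _ := Countable.copy node (can_type node_codeK).

Section Digraph.
Variables p q : nat.
Local Open Scope nat_scope.

(* The index set I_{p,q} = {(i, j) in [p] x [q] : i >= j}, where [p] = {1, ..., p}. *)
Definition cells : seq (nat * nat) :=
  [seq c <- [seq (i, j) | i <- iota 1 p, j <- iota 1 q] | c.2 <= c.1].

Definition nodes : seq node :=
  [seq Grid c.1 c.2 | c <- cells] ++ [seq Grid i 0 | i <- iota 0 p.+1]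
    ++ [:: Src; Snk].

(* An arc is the pair (tail, head).  Row i consists of columns 0, ..., q(i),
   where q(i) = minn i q; the columns 0, ..., q(i+1)-1 of row i < p are the
   tails of diagonal arcs. *)
Definition vert_arcs : seq (node * node) :=
  [seq (Grid i j, Grid i.+1 j) | i <- iota 0 p, j <- iota 0 (minn i q).+1].

Definition diag_arcs : seq (node * node) :=
  [seq (Grid i j, Grid i.+1 j.+1) | i <- iota 0 p, j <- iota 0 (minn i.+1 q)].

Definition arcs : seq (node * node) :=
  vert_arcs ++ diag_arcs ++ [:: (Src, Grid 0 0)]
    ++ [seq (Grid p j, Snk) | j <- iota 0 q.+1].

Definition cell : finType := seq_sub cells.
Definition darc : finType := seq_sub arcs.

Definition arc_tail (a : darc) : node := (val a).1.
Definition arc_head (a : darc) : node := (val a).2.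

Lemma diag_to_subproof (e : cell) :
  (Grid (val e).1.-1 (val e).2.-1, Grid (val e).1 (val e).2) \in arcs.
Proof.
case: e => -[i j] /=; rewrite mem_filter /= => /andP[le_ji].
case/allpairsP=> -[k l] /= [+ + [ei ej]]; rewrite -{}ei -{}ej in le_ji *.
rewrite !mem_iota; case: i le_ji => // i; case: j => // j /= le_ji lt_ip lt_jq.
rewrite !mem_cat; apply/orP; right; apply/orP; left.
apply/allpairsPdep; exists i, j; split; rewrite ?mem_iota //=.
by rewrite leq_min le_ji.
Qed.

Definition diag_to (e : cell) : darc := SeqSub (diag_to_subproof e).

Definition in_diag (W : seq node) : {set darc} :=
  [set a | [&& val a \in diag_arcs, arc_head a \in W & arc_tail a \notin W]].

Definition bar (e : cell) : {set cell} :=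
  [set f | ((val f).1 == (val e).1) && ((val e).2 <= (val f).2)].

Definition column (e : cell) : seq node :=
  [seq Grid k (val e).2 | k <- index_iota (val e).2 (val e).1.+1].

End Digraph.

Definition unit_flow (R : realType) (p q : nat) (y : darc p q -> R) : Prop :=
  [/\ forall a, 0 <= y a,
      forall v, v \in nodes p q -> v != Src -> v != Snk ->
        \sum_(a | arc_head a == v) y a = \sum_(a | arc_tail a == v) y a
    & \sum_(a | arc_tail a == Src) y a = 1].

(* The space R^I_{p,q} x R^A_{p,q} of pairs (x, y); R^o is R as a module over itself. *)
Definition xy_space (R : realType) (p q : nat) : lmodType R :=
  ({ffun cell p q -> R^o} * {ffun darc p q -> R^o})%type.

Definition xpart (R : realType) (p q : nat) (z : xy_space R p q) : cell p q -> R :=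
  z.1.

Definition ypart (R : realType) (p q : nat) (z : xy_space R p q) : darc p q -> R :=
  z.2.

Definition P_polytope (R : realType) (p q : nat) : set (xy_space R p q) :=
  [set z | let x := xpart z in let y := ypart z in
    [/\ unit_flow y,
        forall e : cell p q, y (diag_to e) <= x e
      & forall e : cell p q,
          \sum_(f in bar e) x f <= \sum_(a in in_diag p q (column e)) y a]].

Arguments P_polytope R p q : clear implicits.

(* A vertex is understood as an extreme point. *)
Definition vertex (R : realType) (E : lmodType R) (A : set E) : set E :=
  [set z | A z /\ forall (u v : E) (t : R), A u -> A v -> 0 < t < 1 ->
             z = t *: u + (1 - t) *: v -> u = z /\ v = z].

Definition integral_point (R : realType) (p q : nat) (z : xy_space R p q) : Prop :=
  (forall e, xpart z e \is a Num.int) /\ (forall a, ypart z a \is a Num.int).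

(* Main.v *)
(** Summing conservation over the nodes of row < i and column >= j shows that
    y(in(col_{i,j})) is the total inflow of the nodes (i,l) with l >= j, so (b)
    says that in every row the tail sums of x are bounded by those of the inflow.

    Given z = (x,y) in P, follow a path of arcs with y > 0 from s to t, and let
    c(i) be its column in row i.  Mark in row i the cell m(i) = c(i) if the path
    enters row i diagonally, and otherwise the largest k <= c(i) with x > y on
    the diagonal arc into (i,k) (no cell if there is none).  The path together
    with the marked cells is an integral point u of P.  If m(i) < j <= c(i), the
    step into row i is vertical and (b) is strict at (i,j), because that vertical
    arc carries flow which no x_{ik} with m(i) < k <= c(i) uses.  Hence every
    constraint tight at z is tight at u, i.e. u lies in the minimal face of z,
    and u = z when z is a vertex. *)
Require Import Defs.
From mathcomp Require Import all_boot all_order all_algebra.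
From mathcomp Require Import classical_sets reals.
From mathcomp Require Import zify ring lra.

Set Implicit Arguments.
Unset Strict Implicit.
Unset Printing Implicit Defensive.
Import Order.TTheory GRing.Theory Num.Theory.
Local Open Scope ring_scope.

(** * Membership in the cells, nodes and arcs of the digraph *)

Lemma mem_cells p q i j :
  ((i, j) \in cells p q) = [&& (0 < j)%N, (j <= i)%N, (i <= p)%N & (j <= q)%N].
Proof.
rewrite mem_filter /=; apply/andP/and4P => [[le_ji /allpairsP[[k l] /=]]|].
  by rewrite !mem_iota => -[? ? [ei ej]]; split; lia.
case=> j_gt0 le_ji le_ip le_jq; split=> //.
by apply/allpairsP; exists (i, j); rewrite !mem_iota /=; split=> //; lia.
Qed.

Lemma mem_nodes_grid p q i j :
  (Grid i j \in nodes p q) = (i <= p)%N && (j <= minn i q)%N.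
Proof.
rewrite !mem_cat; apply/or3P/andP => [[/mapP[[k l] + [-> ->]]||]|[le_ip le_j]].
- by rewrite mem_cells => /and4P[]; split; lia.
- by case/mapP=> k; rewrite mem_iota => ? [-> ->]; split; lia.
- by rewrite !inE => /orP[] /eqP.
case: j le_j => [|j] le_j.
  by constructor 2; apply/mapP; exists i; rewrite ?mem_iota //; lia.
by constructor 1; apply/mapP; exists (i, j.+1); rewrite ?mem_cells //; lia.
Qed.

Lemma eq_grid i j k l : (Grid i j == Grid k l) = (i == k) && (j == l).
Proof. by apply/eqP/andP => [[-> ->]|[/eqP-> /eqP->]]. Qed.

Variant arc_spec p q : node * node -> Prop :=
| VertArc i j of (i < p)%N & (j <= minn i q)%N :
    arc_spec p q (Grid i j, Grid i.+1 j)
| DiagArc i j of (i < p)%N & (j < minn i.+1 q)%N :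
    arc_spec p q (Grid i j, Grid i.+1 j.+1)
| SrcArc : arc_spec p q (Src, Grid 0 0)
| SnkArc j of (j <= q)%N : arc_spec p q (Grid p j, Snk).

Lemma arcP p q (a : darc p q) : arc_spec p q (val a).
Proof.
case: a => e /=; rewrite !mem_cat => /or4P[].
- by case/allpairsPdep=> i [j []]; rewrite !mem_iota => ? ? ->; constructor; lia.
- by case/allpairsPdep=> i [j []]; rewrite !mem_iota => ? ? ->; constructor; lia.
- by rewrite inE => /eqP->; constructor.
- by case/mapP=> j; rewrite mem_iota => ? ->; constructor; lia.
Qed.

Lemma src_arc_subproof p q : (Src, Grid 0 0) \in arcs p q.
Proof. by rewrite !mem_cat inE eqxx !orbT. Qed.

Definition src_arc p q : darc p q := SeqSub (src_arc_subproof p q).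

Lemma mem_diag_arcs p q v w :
  ((v, w) \in diag_arcs p q) =
  if (v, w) is (Grid i j, Grid i' j') then
    [&& (i < p)%N, (j < minn i.+1 q)%N, i' == i.+1 & j' == j.+1]
  else false.
Proof.
apply/allpairsPdep/idP => [[k [l [+ + [-> ->]]]]|].
  by rewrite !mem_iota !eqxx !andbT => ? ?; lia.
case: v w => [i j||] // [i' j'||] // /and4P[? ? /eqP-> /eqP->].
by exists i, j; rewrite !mem_iota; split=> //; lia.
Qed.

Lemma mem_column p q (e : cell p q) k l :
  (Grid k l \in column e) = (l == (val e).2) && ((val e).2 <= k <= (val e).1)%N.
Proof.
apply/mapP/andP => [[m + [-> ->]]|[/eqP-> k_bnd]].
  by rewrite mem_index_iota ltnS => ->; split.
by exists k => //; rewrite mem_index_iota ltnS.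
Qed.

Lemma arc_tail_src p q (a : darc p q) : (arc_tail a == Src) = (a == src_arc p q).
Proof. by rewrite -val_eqE /arc_tail; case: (arcP a). Qed.

(** * Conservation over quadrants and the cut identity for columns *)

Section Flow.
Variables (R : realType) (p q : nat) (y : darc p q -> R).

Lemma sum_fiber_seq (f : darc p q -> node) (s : seq node) : uniq s ->
  \sum_(v <- s) \sum_(a | f a == v) y a = \sum_(a | f a \in s) y a.
Proof.
move=> s_uniq; rewrite big_seq (exchange_big_dep (fun a => f a \in s)) /=.
  apply: eq_bigr => a fa_s; rewrite -big_seq_cond; under eq_bigl do rewrite eq_sym.
  by rewrite -big_filter (filter_pred1_uniq s_uniq fa_s) big_seq1.
by move=> v a v_s /eqP->.
Qed.

Definition inflow (v : node) : R := \sum_(a | arc_head a == v) y a.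

Hypothesis yF : unit_flow y.

Lemma flow_src : y (src_arc p q) = 1.
Proof.
case: yF => _ _ <-; under eq_bigl do rewrite arc_tail_src.
by rewrite big_pred1_eq.
Qed.

Definition in_row_from i j (v : node) : bool :=
  if v is Grid k l then (k == i) && (j <= l)%N else false.

Definition quadrant i j (v : node) : bool :=
  if v is Grid k l then (k <= i)%N && (j <= l)%N else false.

(** Conservation is summed over the nodes of the quadrant. The bound i < p keeps out the tails
    [Grid p j] of arcs into [Snk], which are nodes only for j <= p. *)
Lemma quadrant_conservation i j : (i < p)%N ->
  \sum_(a | quadrant i j (arc_head a)) y a = \sum_(a | quadrant i j (arc_tail a)) y a.
Proof.
move=> lt_ip; pose s := [seq v <- undup (nodes p q) | quadrant i j v].
have s_uniq : uniq s by rewrite filter_uniq ?undup_uniq.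
have mem_s v : v \in s = (v \in nodes p q) && quadrant i j v.
  by rewrite mem_filter mem_undup andbC.
rewrite (eq_bigl (fun a => arc_head a \in s)); last first.
  move=> a; rewrite mem_s /arc_head.
  by case: (arcP a) => [k l|k l||l] *; rewrite /= ?mem_nodes_grid; lia.
rewrite [RHS](eq_bigl (fun a => arc_tail a \in s)); last first.
  move=> a; rewrite mem_s /arc_tail.
  by case: (arcP a) => [k l|k l||l] *; rewrite /= ?mem_nodes_grid; lia.
case: yF => _ cons _; rewrite -!sum_fiber_seq //; apply: eq_big_seq => v.
by rewrite mem_s => /andP[v_node v_quad]; apply: cons => //; case: v v_quad {v_node}.
Qed.

(** As j > 0, an arc with head in rows <= i and columns >= j has its tail in rows < i and columns >=
    j, unless it enters column j diagonally. Cancelling the conservation law of the quadrant leaves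
    the heads in row i. *)
Lemma cut_inflow (e : cell p q) :
  \sum_(a in in_diag p q (column e)) y a =
  \sum_(f in bar e) inflow (Grid (val f).1 (val f).2).
Proof.
have [i [j Ee]] : exists i j, val e = (i, j) by case: (val e) => i j; exists i, j.
have := valP e; rewrite Ee mem_cells => /and4P[j_gt0 le_ji le_ip le_jq].
have bar_sum : \sum_(f in bar e) inflow (Grid (val f).1 (val f).2) =
    \sum_(a | in_row_from i j (arc_head a)) y a.
  rewrite /inflow (exchange_big_dep (fun a => in_row_from i j (arc_head a))) /=; last first.
    by move=> f a; rewrite inE Ee /= => /andP[/eqP-> le_jl] /eqP->; rewrite /= eqxx.
  apply: eq_bigr => a; case Ea: (arc_head a) => [k l||] // /andP[/eqP Ek le_jl].
  have kl_cell : (k, l) \in cells p q.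
    move: Ea; rewrite /arc_head mem_cells.
    by case: (arcP a) => [k' l'|k' l'||l'] //= => [? ?|? ?|] [? ?]; lia.
  rewrite (big_pred1 (SeqSub kl_cell)) // => f; rewrite /= -val_eqE inE Ee /=.
  case: (val f) => k' l' /=; rewrite xpair_eqE Ek.
  apply/andP/andP => [[_ /eqP[<- <-]]|[/eqP-> /eqP->]] //.
  by rewrite !eqxx.
rewrite {}bar_sum.
have lt_i1p : (i.-1 < p)%N by lia.
have := quadrant_conservation j lt_i1p.
set S := \sum_(a | quadrant _ _ (arc_head a)) _.
set T := \sum_(a | quadrant _ _ (arc_tail a)) _ => ST.
suff : \sum_(a in in_diag p q (column e)) y a + T =
       \sum_(a | in_row_from i j (arc_head a)) y a + S.
  by rewrite ST => /addIr.
rewrite /S /T [X in X + _ = _]big_mkcond [X in _ + X = _]big_mkcond.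
rewrite [X in _ = X + _]big_mkcond [X in _ = _ + X]big_mkcond -!big_split.
apply: eq_bigr => a _ /=.
(* For each kind of arc both sides are multiples of [y a], so it remains to compare how often the
   arc is counted. *)
rewrite !inE /arc_head /arc_tail; case: (arcP a) => [k l|k l||l] /= *.
all: rewrite mem_diag_arcs ?mem_column ?Ee /= -?mulrb ?addr0 ?add0r -?mulrnDr //.
all: by rewrite -?[0](mulr0n (y a)); congr (_ *+ _); lia.
Qed.

End Flow.

(** * A path in the support of the flow *)

Section Path.
Variables (R : realType) (p q : nat) (y : darc p q -> R).
Hypothesis yF : unit_flow y.

Definition pos_arc v w : bool := [exists a : darc p q, (val a == (v, w)) && (0 < y a)].

(** The path is built greedily: down if that arc carries flow, diagonally otherwise. That the
    diagonal arc then exists and carries flow is left to [pcol_step]. *)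
Fixpoint pcol (i : nat) : nat :=
  if i is i'.+1 then
    if pos_arc (Grid i' (pcol i')) (Grid i (pcol i')) then pcol i' else (pcol i').+1
  else 0.

#[local] Arguments pcol : simpl never.

Definition on_path v : bool := if v is Grid i j then pcol i == j else true.

Lemma inflow_gt0 a v : arc_head a = v -> 0 < y a -> 0 < inflow y v.
Proof.
move=> av a_gt0; case: yF => y_ge0 _ _.
rewrite /inflow (bigD1 a) ?av //= ltr_wpDr //; exact: sumr_ge0.
Qed.

Lemma pos_arc_out i j : (i <= p)%N -> (j <= minn i q)%N -> 0 < inflow y (Grid i j) ->
  exists2 a : darc p q, arc_tail a = Grid i j & 0 < y a.
Proof.
case: yF => y_ge0 cons _ le_ip le_j.
rewrite /inflow cons // ?mem_nodes_grid ?le_ip // => in_gt0.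
have [//|a /andP[/eqP]] := psumr_neq0P _ (elimN eqP (lt0r_neq0 in_gt0)).
by exists a.
Qed.

(** Flow entering the node must leave it, and not to [Snk] since i < p. So if the vertical arc
    carries none, the diagonal one does. *)
Lemma pcol_step i : (i < p)%N -> (pcol i <= minn i q)%N ->
  0 < inflow y (Grid i (pcol i)) -> pos_arc (Grid i (pcol i)) (Grid i.+1 (pcol i.+1)).
Proof.
move=> lt_ip le_pcol /(pos_arc_out (ltnW lt_ip) le_pcol)[a a_tail a_gt0].
rewrite /pcol -/(pcol i); case: ifPn => // /existsPn/(_ a); rewrite a_gt0 andbT => a_vert.
apply/existsP; exists a; rewrite a_gt0 andbT.
move: a_tail a_vert; rewrite /arc_tail; case: (arcP a) => //=.
- by move=> k l _ _ [-> ->]; rewrite eqxx.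
- by move=> k l _ _ [-> ->]; rewrite eqxx.
- by move=> l _ [e_pi]; rewrite e_pi ltnn in lt_ip.
Qed.

(** Both claims go through one induction: finding the next arc takes a genuine node with positive
    inflow. *)
Lemma pcol_in i : (i <= p)%N ->
  (pcol i <= minn i q)%N /\ 0 < inflow y (Grid i (pcol i)).
Proof.
elim: i => [_|i IHi lt_ip].
  by split=> //; apply: (@inflow_gt0 (src_arc p q)); rewrite ?(flow_src yF) ?ltr01.
have [le_pcol in_gt0] := IHi (ltnW lt_ip).
have /existsP[a /andP[/eqP Ea a_gt0]] := pcol_step lt_ip le_pcol in_gt0.
split; last by apply: inflow_gt0 a_gt0; rewrite /arc_head Ea.
by move: (pcol i.+1) Ea => c; case: (arcP a) => // k l ? ? [*]; lia.
Qed.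

Lemma pcol_le i : (i <= p)%N -> (pcol i <= minn i q)%N.
Proof. by case/pcol_in. Qed.

Definition path_next i := if (i < p)%N then Grid i.+1 (pcol i.+1) else Snk.
Definition path_prev i := if i is i'.+1 then Grid i' (pcol i') else Src.

Lemma pos_arc_next i : (i <= p)%N -> pos_arc (Grid i (pcol i)) (path_next i).
Proof.
move=> le_ip; have [le_pcol in_gt0] := pcol_in le_ip.
rewrite /path_next; case: ltnP => [lt_ip|le_pi]; first exact: pcol_step.
have [a a_tail a_gt0] := pos_arc_out le_ip le_pcol in_gt0.
apply/existsP; exists a; rewrite a_gt0 andbT.
move: a_tail; rewrite /arc_tail; case: (arcP a) => //= [k l ? ?|k l ? ?|l ?] [Ek El].
- by lia.
- by lia.
- by rewrite Ek El.
Qed.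

Lemma pos_arc_prev i : (i <= p)%N -> pos_arc (path_prev i) (Grid i (pcol i)).
Proof.
case: i => [_|i lt_ip] /=; last by have := pos_arc_next (ltnW lt_ip); rewrite /path_next lt_ip.
by apply/existsP; exists (src_arc p q); rewrite (flow_src yF) eqxx ltr01.
Qed.

(** Testing the endpoints suffices: with [Src] above row 0 and [Snk] below row p, every arc joins
    consecutive levels, and the path has one node on each. *)
Definition path_flow (a : darc p q) : R := (on_path (arc_tail a) && on_path (arc_head a))%:R.

Lemma path_tail i j (a : darc p q) : (i <= p)%N -> arc_tail a = Grid i j ->
  on_path (arc_tail a) && on_path (arc_head a) = (val a == (Grid i (pcol i), path_next i)).
Proof.
move=> le_ip; rewrite /arc_tail /arc_head /path_next.
by case: (arcP a) => //= [k l lt_kp _|k l lt_kp _|l _] [<- _];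
  rewrite ?lt_kp ?ltnn xpair_eqE !eq_grid !eqxx ?andbT // eq_sym; congr andb; rewrite eq_sym.
Qed.

Lemma path_head i j (a : darc p q) : (i <= p)%N -> arc_head a = Grid i j ->
  on_path (arc_tail a) && on_path (arc_head a) = (val a == (path_prev i, Grid i (pcol i))).
Proof.
move=> le_ip; rewrite /arc_tail /arc_head /path_prev.
by case: (arcP a) => //= [k l lt_kp _|k l lt_kp _|] [<- _];
  rewrite xpair_eqE !eq_grid !eqxx //= eq_sym; congr andb; rewrite eq_sym.
Qed.

Lemma path_inflow i j : (i <= p)%N ->
  \sum_(a | arc_head a == Grid i j) path_flow a = (pcol i == j)%:R.
Proof.
move=> le_ip; have [Ej|ne_j] := eqVneq; last first.
  by apply: big1 => a /eqP a_head; rewrite /path_flow a_head /= (negbTE ne_j) andbF.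
have /existsP[a0 /andP[/eqP Ea0 _]] := pos_arc_prev le_ip.
have a0_head : arc_head a0 = Grid i j by rewrite /arc_head Ea0 Ej.
rewrite (bigD1 a0) ?a0_head //= big1 ?addr0 => [|a /andP[/eqP a_head ne_a]].
  by rewrite /path_flow (path_head le_ip a0_head) Ea0 eqxx.
by rewrite /path_flow (path_head le_ip a_head) -Ea0 val_eqE (negbTE ne_a).
Qed.

Lemma path_outflow i j : (i <= p)%N ->
  \sum_(a | arc_tail a == Grid i j) path_flow a = (pcol i == j)%:R.
Proof.
move=> le_ip; have [Ej|ne_j] := eqVneq; last first.
  by apply: big1 => a /eqP a_tail; rewrite /path_flow a_tail /= (negbTE ne_j).
have /existsP[a0 /andP[/eqP Ea0 _]] := pos_arc_next le_ip.
have a0_tail : arc_tail a0 = Grid i j by rewrite /arc_tail Ea0 Ej.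
rewrite (bigD1 a0) ?a0_tail //= big1 ?addr0 => [|a /andP[/eqP a_tail ne_a]].
  by rewrite /path_flow (path_tail le_ip a0_tail) Ea0 eqxx.
by rewrite /path_flow (path_tail le_ip a_tail) -Ea0 val_eqE (negbTE ne_a).
Qed.

Lemma path_unit_flow : unit_flow path_flow.
Proof.
split=> [a|[i j||] // v_node _ _|]; first exact: ler0n.
  by move: v_node; rewrite mem_nodes_grid => /andP[le_ip _]; rewrite path_inflow ?path_outflow.
under eq_bigl do rewrite arc_tail_src.
by rewrite big_pred1_eq.
Qed.

Lemma path_flow_supp a : y a = 0 -> path_flow a = 0.
Proof.
move=> a_eq0; rewrite /path_flow; case: andP => // -[].
(* The negative case leaves only the source arc, which carries flow 1. *)
have [i_tail|] := boolP (if arc_tail a is Grid i j then (i <= p)%N else false).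
  case Ea: (arc_tail a) i_tail => [i j||] // le_ip on_tail on_head.
  have := path_tail le_ip Ea; rewrite Ea on_tail on_head => /esym/eqP Va.
  have /existsP[b /andP[/eqP Vb]] := pos_arc_next le_ip.
  by rewrite (_ : b = a) ?a_eq0 ?ltxx //; apply: val_inj; rewrite Vb.
move=> tail_out _ _; have : a == src_arc p q.
  rewrite -arc_tail_src; move: tail_out; rewrite /arc_tail.
  by case: (arcP a) => //= [k l|k l|l]; [move=> /ltnW-> | move=> /ltnW-> | rewrite leqnn].
move=> /eqP a_src; have := flow_src yF; rewrite -a_src a_eq0 => /esym/eqP.
by rewrite oner_eq0.
Qed.

End Path.
Arguments pcol : simpl never.

(** * Tail sums along a row and the marked cells *)

Lemma sum_bar_indicator (R : realType) p q (e : cell p q) (g : nat -> nat) :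
  (g (val e).1 <= minn (val e).1 q)%N ->
  \sum_(f in bar e) (g (val f).1 == (val f).2)%:R = ((val e).2 <= g (val e).1)%:R :> R.
Proof.
have [i [j Ee]] : exists i j, val e = (i, j) by case: (val e) => i j; exists i, j.
have := valP e; rewrite Ee mem_cells => /and4P[j_gt0 le_ji le_ip le_jq] /= le_g.
have [le_jg|lt_gj] := leqP; last first.
  apply: big1 => f; rewrite inE Ee /= => /andP[/eqP-> le_jf].
  by rewrite ltn_eqF ?(leq_trans lt_gj).
(* This cell gives the only nonzero term of the sum. *)
have ig_cell : (i, g i) \in cells p q by rewrite mem_cells; lia.
rewrite (bigD1 (SeqSub ig_cell)) ?inE ?Ee ?eqxx //= big1 ?addr0 => [//|f].
rewrite inE Ee -val_eqE /=; case: (ssval f) => k l /= /andP[/andP[/eqP-> _]].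
by rewrite xpair_eqE eqxx /= eq_sym => /negbTE->.
Qed.

Section Mark.
Variables (R : realType) (p q : nat) (x : cell p q -> R) (y : darc p q -> R).
Hypothesis yF : unit_flow y.
Hypothesis bar_le_in_diag : forall e,
  \sum_(f in bar e) x f <= \sum_(a in in_diag p q (column e)) y a.

(** Strictness of (a) at (i,k); the existential makes it false when (i,k) is not a cell. *)
Definition gap i k := [exists e : cell p q, (val e == (i, k)) && (y (diag_to e) < x e)].

(** Equal columns in rows i-1 and i mean a vertical step. The empty maximum is 0, the column of no
    cell, and stands for no mark. *)
Definition mark i : nat :=
  if pcol y i == pcol y i.-1 then \max_(k < (pcol y i).+1 | gap i k) k else pcol y i.

Lemma mark_le i : (mark i <= pcol y i)%N.
Proof.
rewrite /mark; case: ifP => // _.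
by apply/bigmax_leqP => k _; rewrite -ltnS.
Qed.

Lemma gap_le_mark i k : pcol y i = pcol y i.-1 -> (k <= pcol y i)%N -> gap i k ->
  (k <= mark i)%N.
Proof.
rewrite -ltnS => Ei lt_k gap_k; rewrite /mark Ei eqxx -Ei.
exact: (leq_bigmax_cond (Ordinal lt_k)).
Qed.

(** A maximum other than the default 0 is attained at a gap. *)
Lemma mark_gap i : pcol y i = pcol y i.-1 -> (0 < mark i)%N -> gap i (mark i).
Proof.
move=> Ei; rewrite /mark Ei eqxx -Ei.
by elim/big_ind: _ => [//|a b gap_a gap_b|//]; rewrite /maxn; case: ifP.
Qed.

Lemma pcolS i : pcol y i.+1 = pcol y i \/ pcol y i.+1 = (pcol y i).+1.
Proof. by rewrite /pcol -/(pcol y i); case: ifP; [left|right]. Qed.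

Definition mark_x (e : cell p q) : R := (mark (val e).1 == (val e).2)%:R.

Lemma path_flow_diag e : path_flow y (diag_to e) =
  ((pcol y (val e).1.-1 == (val e).2.-1) && (pcol y (val e).1 == (val e).2))%:R.
Proof. by []. Qed.

Lemma path_diag_le_mark e : path_flow y (diag_to e) <= mark_x e.
Proof.
rewrite path_flow_diag ler_nat; case: andP => //= -[/eqP E1 /eqP E2].
have := valP e; rewrite [val e]surjective_pairing mem_cells => /and4P[e2_gt0 _ _ _].
rewrite /mark E1 E2 ifN ?eqxx //.
by case: (val e).2 e2_gt0 => // k _; rewrite /= -addn1 -[eqbRHS]addn0 eqn_add2l.
Qed.

(** A mark after a vertical step lies at a gap, which tightness of (a) excludes. So a marked cell
    was entered diagonally, and the path uses its diagonal arc. *)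
Lemma path_diag_mark_tight e : y (diag_to e) = x e -> path_flow y (diag_to e) = mark_x e.
Proof.
move=> e_tight; apply/le_anti; rewrite path_diag_le_mark /= /mark_x.
case: eqP => [Em|_]; last exact: ler0n.
have [i [j Ee]] : exists i j, val e = (i, j) by case: (val e) => i j; exists i, j.
have := valP e; rewrite path_flow_diag Ee mem_cells /= in Em *.
move=> /and4P[j_gt0 le_ji le_ip le_jq].
have [Ei|ne_i] := eqVneq (pcol y i) (pcol y i.-1).
  have := mark_gap Ei; rewrite Em => /(_ j_gt0)/existsP[f /andP[/eqP Ef]].
  by rewrite (_ : f = e) ?e_tight ?ltxx //; apply: val_inj; rewrite Ee.
move: Em; rewrite /mark (negbTE ne_i) => Em; rewrite Em eqxx.
case: i {Ee le_ip} ne_i le_ji Em => [|i] /= ne_i le_ji Em; first by lia.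
have [E|E] := pcolS i; first by rewrite E eqxx in ne_i.
by rewrite (_ : pcol y i == j.-1) //; apply/eqP; lia.
Qed.

Lemma mark_bar e : \sum_(f in bar e) mark_x f = ((val e).2 <= mark (val e).1)%:R.
Proof.
have := valP e; rewrite [val e]surjective_pairing mem_cells => /and4P[_ _ le_ip _].
by apply: sum_bar_indicator; rewrite (leq_trans (mark_le _)) ?pcol_le.
Qed.

(** By the cut identity this is the inflow of the path in row i from column j on, and that inflow is
    concentrated at [pcol y i]. *)
Lemma path_in_diag (e : cell p q) :
  \sum_(a in in_diag p q (column e)) path_flow y a = ((val e).2 <= pcol y (val e).1)%:R.
Proof.
have := valP e; rewrite [val e]surjective_pairing mem_cells => /and4P[_ _ le_ip _].
rewrite (cut_inflow (path_unit_flow yF)) -sum_bar_indicator ?pcol_le //.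
apply: eq_bigr => f; rewrite inE => /andP[/eqP Ef _].
by rewrite /inflow path_inflow // Ef.
Qed.

Lemma mark_bar_le (e : cell p q) :
  \sum_(f in bar e) mark_x f <= \sum_(a in in_diag p q (column e)) path_flow y a.
Proof.
rewrite mark_bar path_in_diag ler_nat; case: (leqP _ (mark _)) => // le_jm.
by rewrite (leq_trans le_jm) ?mark_le.
Qed.

Lemma diag_le_inflow (f : cell p q) : y (diag_to f) <= inflow y (Grid (val f).1 (val f).2).
Proof.
case: yF => y_ge0 _ _; rewrite /inflow (bigD1 (diag_to f)) ?eqxx //= lerDl.
exact: sumr_ge0.
Qed.

(** The path enters the cell by a vertical arc of positive flow, which adds to the diagonal one. *)
Lemma vert_lt_inflow (f : cell p q) : pcol y (val f).1 = (val f).2 ->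
  pcol y (val f).1 = pcol y (val f).1.-1 ->
  y (diag_to f) < inflow y (Grid (val f).1 (val f).2).
Proof.
have [i [j Ef]] : exists i j, val f = (i, j) by case: (val f) => i j; exists i, j.
have := valP f; rewrite Ef mem_cells /= => /and4P[j_gt0 le_ji le_ip le_jq] Ej Ei.
have /existsP[a /andP[/eqP Ea a_gt0]] := pos_arc_prev yF le_ip.
have ne_a : a != diag_to f.
  rewrite -val_eqE Ea /= Ef /= xpair_eqE negb_and /path_prev.
  case: i Ei {Ef Ea le_ip le_ji} Ej => //= i <- ->.
  by rewrite eq_grid eqxx /=; lia.
case: yF => y_ge0 _ _; rewrite /inflow (bigD1 (diag_to f)) /=; last by rewrite /arc_head /= Ef.
rewrite ltrDl (bigD1 a) /=; last by rewrite /arc_head Ea Ej eqxx.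
by rewrite ltr_wpDr ?sumr_ge0.
Qed.

(** The two 0/1 sums differ only if mark i < j <= pcol i. In that case (b) is strict at (i,j): x is
    compared with the inflow cell by cell up to column l = pcol i, and by (b) beyond it. *)
Lemma mark_bar_tight (e : cell p q) :
  \sum_(f in bar e) x f = \sum_(a in in_diag p q (column e)) y a ->
  \sum_(f in bar e) mark_x f = \sum_(a in in_diag p q (column e)) path_flow y a.
Proof.
have [i [j Ee]] : exists i j, val e = (i, j) by case: (val e) => i j; exists i, j.
have := valP e; rewrite mark_bar path_in_diag Ee mem_cells /=.
move=> /and4P[j_gt0 le_ji le_ip le_jq] e_tight.
have [le_jm|lt_mj] := leqP j (mark i).
  by rewrite (leq_trans le_jm) ?mark_le.
case: leqP => // le_jc; exfalso.
(* After a diagonal step the mark would be [pcol y i] itself. *)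
have Ei : pcol y i = pcol y i.-1.
  by apply/eqP; apply: contraTT le_jc => ne_i; move: lt_mj; rewrite /mark (negbTE ne_i) ltnNge.
have le_c := pcol_le yF le_ip; set l := pcol y i in le_jc le_c.
have il_cell : (i, l) \in cells p q by rewrite mem_cells; lia.
have := e_tight; rewrite cut_inflow //; apply/eqP; rewrite lt_eqF //.
pose small (f : cell p q) := ((val f).2 <= l)%N.
rewrite (bigID small) [ltRHS](bigID small) /=; apply: ltr_leD.
  (* Columns j to l lie right of the mark and have no gap, so x is at most the diagonal flow; at
     column l the vertical arc lifts the inflow strictly above that. *)
  have no_gap f : (f \in bar e) && small f -> x f <= y (diag_to f).
    rewrite inE Ee /= => /andP[/andP[/eqP Ef le_jf] le_fl]; rewrite leNgt.
    apply/negP => f_gap.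
    suff: ((val f).2 <= mark i)%N by rewrite leqNgt (leq_trans lt_mj le_jf).
    apply: gap_le_mark => //; apply/existsP; exists f.
    by rewrite f_gap -Ef -surjective_pairing eqxx.
  pose f0 : cell p q := SeqSub il_cell.
  have f0_in : (f0 \in bar e) && small f0 by rewrite inE Ee /= eqxx le_jc /small /=.
  rewrite (bigD1 f0) // [ltRHS](bigD1 f0) //=; apply: ltr_leD.
    by apply: le_lt_trans (no_gap _ f0_in) _; apply: vert_lt_inflow.
  apply: ler_sum => f /andP[f_in _]; exact: le_trans (no_gap _ f_in) (diag_le_inflow f).
(* Beyond l, (b) at (i,l+1) bounds the tail sum; if that is not a cell, the tail is empty. *)
have [il1_cell|no_cell] := boolP ((i, l.+1) \in cells p q).
  pose e' : cell p q := SeqSub il1_cell.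
  have Ebar f : (f \in bar e) && ~~ small f = (f \in bar e').
    rewrite !inE Ee /= /small -ltnNge -andbA; congr andb.
    by apply: andb_idl => lt_lf; exact: leq_trans le_jc (ltnW lt_lf).
  by rewrite !(eq_bigl _ _ Ebar) -cut_inflow.
rewrite !big_pred0 // => f; apply/negbTE; apply: contra no_cell.
all: have := valP f; rewrite [val f]surjective_pairing !mem_cells inE Ee /small /=.
all: by move=> /and4P[? ? ? ?] /andP[/andP[/eqP ? ?] ?]; lia.
Qed.

End Mark.

(** * Scaling of slacks and minimal faces *)

Lemma small_scaling (R : realFieldType) (I : finType) (s s' : I -> R) :
  (forall i, 0 <= s i) -> (forall i, 0 <= s' i) -> (forall i, s i = 0 -> s' i = 0) ->
  exists2 t, 0 < t < 1 & forall i, t * s' i <= s i.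
Proof.
move=> s_ge0 s'_ge0 s0.
have [t [t_gt0 t_lt1 t_le]] :
    exists t, [/\ 0 < t, t < 1 & {in enum I, forall i, t * s' i <= s i}].
  elim: (enum I) => [|i r [t [t_gt0 t_lt1 t_le]]].
    (* Starting below 1 ensures t < 1, since later steps only take minima. *)
    by exists 2^-1; split=> //; lra.
  have [t' t'_gt0 t'_le] : exists2 t', 0 < t' & t' * s' i <= s i.
    have [si0|s_neq0] := eqVneq (s i) 0; first by exists 1; rewrite ?ltr01 // si0 s0 ?mulr0.
    have d_gt0 : 0 < s' i + 1 by rewrite ltr_wpDl.
    (* The added 1 avoids dividing by zero when [s' i] vanishes. *)
    exists (s i / (s' i + 1)); first by rewrite divr_gt0 // lt0r s_neq0 s_ge0.
    by rewrite mulrAC ler_pdivrMr // ler_wpM2l // lerDl.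
  exists (Num.min t t'); split; rewrite ?lt_min ?t_gt0 // ?gt_min ?t_lt1 // => k.
  rewrite inE => /predU1P[->|k_r].
    by apply: le_trans t'_le; rewrite ler_wpM2r // ge_min lexx orbT.
  by apply: le_trans (t_le _ k_r); rewrite ler_wpM2r // ge_min lexx.
by exists t => [|i]; rewrite ?t_gt0 // t_le ?mem_enum.
Qed.

Lemma xpart_lin (R : realType) p q (a b : R) (z w : xy_space R p q) e :
  xpart (a *: z + b *: w) e = a * xpart z e + b * xpart w e.
Proof. by rewrite /xpart !ffunE. Qed.

Lemma ypart_lin (R : realType) p q (a b : R) (z w : xy_space R p q) e :
  ypart (a *: z + b *: w) e = a * ypart z e + b * ypart w e.
Proof. by rewrite /ypart !ffunE. Qed.

(** Since u is tight wherever z is, z can be moved a little away from u inside the polytope, to v =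
    (z - t u)/(1 - t). Then z is a proper convex combination of u and v, and extremality gives u =
    z. *)
Lemma vertex_minimal_face (R : realType) (p q : nat) (z u : xy_space R p q) :
  vertex (P_polytope R p q) z -> P_polytope R p q u ->
  (forall a, ypart z a = 0 -> ypart u a = 0) ->
  (forall e, ypart z (diag_to e) = xpart z e -> ypart u (diag_to e) = xpart u e) ->
  (forall e : cell p q,
     \sum_(f in bar e) xpart z f = \sum_(a in in_diag p q (column e)) ypart z a ->
     \sum_(f in bar e) xpart u f = \sum_(a in in_diag p q (column e)) ypart u a) ->
  u = z.
Proof.
move=> [zP z_ext] uP y_tight diag_tight bar_tight.
case: (zP) => -[zy_ge0 z_cons z_src] z_diag z_bar.
case: (uP) => -[uy_ge0 u_cons u_src] u_diag u_bar.
(* All inequalities of the polytope, indexed by one finite type; each slack is linear in the point,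
   without constant term. *)
pose slack (w : xy_space R p q) (c : darc p q + (cell p q + cell p q)) : R :=
  match c with
  | inl a => ypart w a
  | inr (inl e) => xpart w e - ypart w (diag_to e)
  | inr (inr e) => \sum_(a in in_diag p q (column e)) ypart w a - \sum_(f in bar e) xpart w f
  end.
have [c|c|c|t /andP[t_gt0 t_lt1] t_le] := @small_scaling R _ (slack z) (slack u).
- by case: c => [a|[e|e]] /=; rewrite ?subr_ge0.
- by case: c => [a|[e|e]] /=; rewrite ?subr_ge0.
- case: c => [a|[e|e]] /=; first exact: y_tight.
    by move/eqP; rewrite subr_eq0 => /eqP/esym/diag_tight->; rewrite subrr.
  by move/eqP; rewrite subr_eq0 => /eqP/esym/bar_tight->; rewrite subrr.
have t1_gt0 : 0 < 1 - t by rewrite subr_gt0.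
pose r := (1 - t)^-1; have r_ge0 : 0 <= r by rewrite invr_ge0 ltW.
(* The coefficients of z and u in v sum to 1, which keeps the flow value one. *)
have r_def : r - r * t = 1 by rewrite -{1}[r]mulr1 -mulrBr mulVf ?gt_eqF.
pose v : xy_space R p q := r *: z + (- (r * t)) *: u.
have combine (s s' : R) : t * s' <= s -> 0 <= r * s + - (r * t) * s'.
  by move=> le_s; rewrite mulNr -mulrA -mulrBr mulr_ge0 ?subr_ge0.
have vP : P_polytope R p q v.
  split; first split.
  - by move=> a; rewrite ypart_lin; apply: combine; exact: t_le (inl a).
  - move=> w w_node w_src w_snk.
    under eq_bigr do rewrite ypart_lin; under [RHS]eq_bigr do rewrite ypart_lin.
    by rewrite !big_split /= -!mulr_sumr z_cons ?u_cons.
  - under eq_bigr do rewrite ypart_lin.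
    by rewrite big_split /= -!mulr_sumr z_src u_src !mulr1.
  - move=> e; rewrite ypart_lin xpart_lin -subr_ge0.
    have := combine _ _ (t_le (inr (inl e))); rewrite /slack; congr (0 <= _); ring.
  - move=> e; under eq_bigr do rewrite xpart_lin; under [leRHS]eq_bigr do rewrite ypart_lin.
    rewrite !big_split /= -!mulr_sumr -subr_ge0.
    have := combine _ _ (t_le (inr (inr e))); rewrite /slack; congr (0 <= _); ring.
have zE : z = t *: u + (1 - t) *: v.
  rewrite /v scalerDr !scalerA mulrN mulrA mulfV ?gt_eqF // mul1r scale1r.
  by rewrite scaleNr addrCA subrr addr0.
by have [] := z_ext u v t uP vP _ zE; rewrite ?t_gt0.
Qed.

(** * Integrality of the vertices *)

Theorem theorem4 (R : realType) (p q : nat) (hq : (1 <= q)%N) (hpq : (q <= p)%N)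
    (z : xy_space R p q) :
  vertex (P_polytope R p q) z -> integral_point z.
Proof.
move=> z_vertex; have [[yF _ bar_le] _] := z_vertex.
(* The path with its marked cells, a point with 0/1 coordinates. *)
pose u : xy_space R p q :=
  ([ffun e => mark_x (xpart z) (ypart z) e], [ffun a => path_flow (ypart z) a]).
have uxE e : xpart u e = mark_x (xpart z) (ypart z) e by rewrite /xpart ffunE.
have uyE a : ypart u a = path_flow (ypart z) a by rewrite /ypart ffunE.
have <- : u = z.
  apply: vertex_minimal_face => //.
  - split; first split.
    + by move=> a; rewrite uyE ler0n.
    + move=> v v_node v_src v_snk; under eq_bigr do rewrite uyE.
      under [RHS]eq_bigr do rewrite uyE.
      by case: (path_unit_flow yF) => _ ->.
    + by under eq_bigr do rewrite uyE; case: (path_unit_flow yF).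
    + by move=> e; rewrite uxE uyE path_diag_le_mark.
    + move=> e; under eq_bigr do rewrite uxE; under [leRHS]eq_bigr do rewrite uyE.
      exact: mark_bar_le.
  - by move=> a; rewrite uyE; apply: path_flow_supp.
  - by move=> e; rewrite uxE uyE; apply: path_diag_mark_tight.
  - move=> e; under [X in _ -> X = _]eq_bigr do rewrite uxE.
    under [X in _ -> _ = X]eq_bigr do rewrite uyE.
    exact: mark_bar_tight.
by split=> [e|a]; rewrite ?uxE ?uyE; apply: natr_int.
Qed.
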